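(* There is a function (error term) $\delta(p)$ of $p\in(0,1)$ such that for every $0<p<1$ $$\lim_{N\to\infty}\mathbb{E}[Y^2] = \frac{4}{p^4}+\delta(p),$$ where $\lim_{p\to 0}\delta(p)/p^{-4}=0$.
   Context: For a real number $0<p<1$ and an integer $N\ge 0$, let $A$ be a random subset of $\{0,\dots,N\}$ in which each integer in $\{0,\dots,N\}$ is included independently with probability $p$, and let $A+A=\{a+b : a,b\in A\}$ ($a=b$ allowed). Let $Y=|\{0\le n\le N : n\notin A+A\}|$ (a random variable depending on $p$ and $N$). *)

(* Defs.v *)
From HB Require Import structures.
From mathcomp Require Import all_boot all_order all_algebra.
From mathcomp Require Import all_classical all_reals all_analysis.

Set Implicit Arguments.
Unset Strict Implicit.
Unset Printing Implicit Defensive.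

Import Order.TTheory GRing.Theory Num.Theory.
Import numFieldNormedType.Exports.

Local Open Scope ring_scope.

(* {0, ..., N} is 'I_N.+1; sums may exceed N, so A + A is a sequence of
   naturals, used only through membership. *)
Definition sumset (N : nat) (A : {set 'I_N.+1}) : seq nat :=
  [seq (a + b)%N | a : 'I_N.+1 <- enum A, b : 'I_N.+1 <- enum A].

Definition missing_sums (N : nat) (A : {set 'I_N.+1}) : {set 'I_N.+1} :=
  [set n : 'I_N.+1 | (n : nat) \notin sumset A]%SET.

(* Law of the random subset of a finite type that includes each element
   independently with probability p: the product of Bernoulli(p) laws. *)
Definition random_subset_law (R : realType) (T : finType) (p : R)
    (A : {set T}) : R :=
  \prod_(i : T) (if i \in A then p else 1 - p).

Definition expectation_random_subset (R : realType) (T : finType) (p : R)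
    (X : {set T} -> R) : R :=
  \sum_(A : {set T}) random_subset_law p A * X A.

Definition Y (R : realType) (N : nat) (A : {set 'I_N.+1}) : R :=
  #|missing_sums A|%:R.

(* Main.v *)
Require Import Defs.
From HB Require Import structures.
From mathcomp Require Import all_boot all_order all_algebra.
From mathcomp Require Import all_classical all_reals all_analysis.
From mathcomp Require Import finset ring lra zify.

Set Implicit Arguments.
Unset Strict Implicit.
Unset Printing Implicit Defensive.

Import Order.TTheory GRing.Theory Num.Theory.
Import numFieldNormedType.Exports.

Local Open Scope ring_scope.

(** By linearity E[Y^2] is the sum, over m, n <= N, of the probability that
    neither m nor n lies in A + A.  Join i and j when i + j is m or n: the event
    says that A is a stable set of this graph, where a vertex with i + i = m or
    i + i = n carries a loop.

    Every vertex has at most one neighbour for each of the two sums, and in every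
    nonempty vertex set S the maximum or the minimum has degree at most one
    ([peelable_sum_rel]).  Conditioning on such a leaf v with neighbour u gives
      f(S) = (1 - p) f(S - v) + p (1 - p) f(S - v - u)
    for the probability f(S) that A is stable on S.  This recursion resembles the
    one for a path, and unrolling it bounds f(S) in terms of the number a(S) of
    ordered adjacent pairs, loops being counted once:
    - f(S) >= nu^a(S) with nu^2 = 1 - p^2, up to a factor 1 - p per loop
      ([stable_prob_lower]): each edge is avoided with probability 1 - p^2 and
      these events are positively correlated;
    - f(S) <= mu^a(S) with mu^2 = 1 - p^2 / (1 + p) ([stable_prob_upper]): on a
      path the correlation changes the factor per edge only by O(p^3).

    On all of {0, ..., N}, a = m + n + 2 if m and n differ, and a = n + 1 if they
    coincide.  Summing geometric series,
      E[Y^2] <= (1 - mu)^-2 + (1 - mu)^-1, where (1 - mu)^-1 <= 2 (1 + p) / p^2,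
      E[Y^2] >= E[Y]^2, where E[Y] >= (1 - p) nu (1 - nu^(N+1)) / (1 - nu),
    and both sides are 4/p^4 (1 + O(p)).  The limit in N exists because E[Y^2] is
    bounded and nondecreasing: whether n belongs to A + A depends only on the
    elements of A up to n, so Y can only grow with N. *)

(** * Expectations over a random subset *)

Lemma random_subset_law_ge0 (R : realType) (T : finType) (p : R) (A : {set T}) :
  0 < p < 1 -> 0 <= random_subset_law p A.
Proof.
by move=> /andP[p0 p1]; apply: prodr_ge0 => i _; case: ifP => _; lra.
Qed.

Lemma random_subset_law_sum1 (R : realType) (T : finType) (p : R) :
  \sum_(A : {set T}) random_subset_law p A = 1.
Proof.
rewrite -(bigA_distr 1 +%R (fun=> p) (fun=> 1 - p)) /=.
by apply: big1 => i _; rewrite addrC subrK.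
Qed.

Lemma subset_expectation_sum (R : realType) (T I : finType) (p : R)
    (X : I -> {set T} -> R) :
  expectation_random_subset p (fun A => \sum_i X i A) =
  \sum_i expectation_random_subset p (X i).
Proof.
by rewrite exchange_big; apply: eq_bigr => A _; rewrite mulr_sumr.
Qed.

Lemma subset_expectation_le (R : realType) (T : finType) (p : R)
    (X X' : {set T} -> R) :
  0 < p < 1 -> (forall A, X A <= X' A) ->
  expectation_random_subset p X <= expectation_random_subset p X'.
Proof.
move=> p01 leX; apply: ler_sum => A _.
by rewrite ler_wpM2l ?random_subset_law_ge0.
Qed.

Lemma subset_expectation_cst (R : realType) (T : finType) (p c : R) :
  expectation_random_subset p (T := T) (fun=> c) = c.
Proof.
by rewrite /expectation_random_subset -mulr_suml random_subset_law_sum1 mul1r.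
Qed.

(** Nonnegativity of the variance. *)
Lemma subset_expectation_sqr_ge (R : realType) (T : finType) (p : R)
    (X : {set T} -> R) :
  0 < p < 1 ->
  expectation_random_subset p X ^+ 2 <=
  expectation_random_subset p (fun A => X A ^+ 2).
Proof.
move=> p01; set c := expectation_random_subset p X.
have : 0 <= expectation_random_subset p (fun A => (X A - c) ^+ 2).
  rewrite -[leLHS](subset_expectation_cst T p); apply: subset_expectation_le => // A.
  exact: sqr_ge0.
rewrite /expectation_random_subset.
under eq_bigr => A _.
  have -> : random_subset_law p A * (X A - c) ^+ 2 =
    random_subset_law p A * X A ^+ 2
    + (- (2 * c) * (random_subset_law p A * X A)
       + c ^+ 2 * random_subset_law p A) by ring.
  over.
rewrite !big_split -!mulr_sumr /= random_subset_law_sum1.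
by rewrite -/(expectation_random_subset p X) -/c; lra.
Qed.

(** The weight of a set is a factor for [v] times a weight that ignores [v]; on
    the right-hand side the former sums to [p + (1 - p)]. *)
Lemma subset_expectation_condition (R : realType) (T : finType) (p : R) (v : T)
    (X : {set T} -> R) :
  expectation_random_subset p X =
  p * expectation_random_subset p (fun A => X (v |: A)) +
  (1 - p) * expectation_random_subset p (fun A => X (A :\ v)).
Proof.
pose rest (A : {set T}) := \prod_(i | i != v) (if i \in A then p else 1 - p).
pose M (X : {set T} -> R) := \sum_(A : {set T} | v \notin A) rest A * X A.
have lawE (A : {set T}) :
    random_subset_law p A = (if v \in A then p else 1 - p) * rest A.
  by rewrite /random_subset_law (bigD1 v).
have restU (A : {set T}) : rest (v |: A) = rest A.
  by apply: eq_bigr => i /negPf iv; rewrite !inE iv.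
have E (Z : {set T} -> R) : expectation_random_subset p Z =
    p * M (fun A => Z (v |: A)) + (1 - p) * M (fun A => Z (A :\ v)).
  rewrite /expectation_random_subset (bigID (fun A : {set T} => v \in A)) /=.
  congr (_ + _); rewrite mulr_sumr.
    rewrite (reindex_onto (fun A => v |: A) (fun A => A :\ v)) /=; last first.
      by move=> A vA; rewrite setD1K.
    apply: eq_big => [A|A vA].
      rewrite setU11 /=; apply/eqP/idP => [<-|vA]; first by rewrite setD11.
      by rewrite setU1K.
    by rewrite lawE setU11 restU mulrA.
  apply: eq_bigr => A vA; rewrite lawE (negPf vA) -mulrA.
  congr (_ * (_ * Z _)); apply/setP => i; rewrite !inE.
  by case: eqP => // ->; rewrite (negPf vA).
rewrite (E X) !E.
have -> : M (fun A => X (v |: (v |: A))) = M (fun A => X (v |: A)).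
  by apply: eq_bigr => A _; rewrite setUA setUid.
have -> : M (fun A => X (v |: A :\ v)) = M (fun A => X (v |: A)).
  apply: eq_bigr => A vA; congr (_ * X _); apply/setP => i.
  by rewrite !inE; case: eqP.
have -> : M (fun A => X ((v |: A) :\ v)) = M (fun A => X (A :\ v)).
  apply: eq_bigr => A vA; congr (_ * X _); apply/setP => i.
  by rewrite !inE; case: eqP.
have -> : M (fun A => X (A :\ v :\ v)) = M (fun A => X (A :\ v)).
  apply: eq_bigr => A vA; congr (_ * X _); apply/setP => i.
  by rewrite !inE; case: eqP.
ring.
Qed.

(** The trace of the random subset on a smaller type is again a random subset
    of the same kind: the weights of the subsets with a given trace factor over
    the points, and every point outside the image of [h] contributes
    [p + (1 - p)]. *)
Lemma subset_expectation_preimset (R : realType) (T T' : finType) (p : R)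
    (h : T -> T') (X : {set T} -> R) :
  injective h ->
  expectation_random_subset p (fun A => X (h @^-1: A)) =
  expectation_random_subset p X.
Proof.
move=> hI; rewrite /expectation_random_subset.
rewrite (partition_big (fun A : {set T'} => h @^-1: A) xpredT) //=.
apply: eq_bigr => B _.
under eq_bigr => A /eqP -> do [].
rewrite -mulr_suml; congr (_ * _).
(* Points of the image are forced in or out of the subset according to B. *)
pose F i := if i \in h @: ~: B then 0 else p.
pose G i := if i \in h @: B then 0 else 1 - p.
have FGE (A : {set T'}) :
    \prod_i (if i \in A then F i else G i) =
    if h @^-1: A == B then random_subset_law p A else 0.
  case: eqP => [AB|/eqP AB].
    apply: eq_bigr => i _; rewrite /F /G; case: ifP => iA; case: ifP => //.
      by case/imsetP => j + ij; rewrite -AB !inE -ij iA.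
    by case/imsetP => j + ij; rewrite -AB !inE -ij iA.
  have [j jAB] : exists j, (h j \in A) != (j \in B).
    apply/existsP; apply: contraR AB; rewrite negb_exists => /forallP AB.
    by apply/eqP/setP => j; rewrite !inE; apply/eqP; move: (AB j); rewrite negbK.
  rewrite (bigD1 (h j)) //= /F /G !mem_imset // !inE.
  by move: jAB; case: (h j \in A); case: (j \in B) => //= _; rewrite mul0r.
transitivity (\sum_(A : {set T'}) \prod_i (if i \in A then F i else G i)).
  by rewrite (eq_bigr _ (fun A _ => FGE A)) -big_mkcond.
rewrite -(bigA_distr 1 +%R) /= (bigID (mem (h @: setT))) /=.
rewrite [X in _ * X]big1 ?mulr1; last first.
  move=> i ih; have ihF C : (i \in h @: C) = false.
    by apply: contraNF ih => /imsetP[j _ ->]; rewrite imset_f.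
  by rewrite /F /G !ihF addrC subrK.
rewrite big_imset /=; last by move=> ? ? _ _; exact: hI.
apply: eq_big => [j|j _]; first by rewrite inE.
by rewrite /F /G !mem_imset // inE; case: (j \in B); rewrite ?addr0 ?add0r.
Qed.

(** * Stable sets of a graph *)

(** Taking [u = v] shows that a stable set contains no vertex with a loop. *)
Definition stable (T : finType) (e : rel T) (A : {set T}) : bool :=
  [forall u in A, forall v in A, ~~ e u v].

Definition stable_prob (R : realType) (T : finType) (p : R) (e : rel T)
    (S : {set T}) : R :=
  expectation_random_subset p (fun A => (stable e (S :&: A))%:R).

Definition deg (T : finType) (e : rel T) (S : {set T}) (v : T) : nat :=
  (\sum_(w in S) e v w)%N.

(** Ordered pairs make this additive over the vertices: an edge between distinct
    vertices counts twice, a loop once. *)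
Definition arcs (T : finType) (e : rel T) (S : {set T}) : nat :=
  (\sum_(u in S) deg e S u)%N.

Definition loops (T : finType) (e : rel T) (S : {set T}) : nat :=
  (\sum_(u in S) e u u)%N.

(** For a symmetric relation without loops this says that the graph is a forest:
    leaves can be removed one after the other until nothing remains. *)
Definition peelable (T : finType) (e : rel T) : Prop :=
  forall S : {set T}, S != finset.set0 -> exists2 v, v \in S & (deg e S v <= 1)%N.

Lemma stableP (T : finType) (e : rel T) (A : {set T}) :
  reflect {in A &, forall u v, ~~ e u v} (stable e A).
Proof.
apply: (iffP forall_inP) => [H u v uA vA|H u uA].
  by have /forall_inP := H u uA; apply.
by apply/forall_inP => v vA; exact: H.
Qed.

Lemma stableU1 (T : finType) (e : rel T) (v : T) (B : {set T}) :
  symmetric e ->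
  stable e (v |: B) =
  [&& ~~ e v v, [forall w in B, ~~ e v w] & stable e B].
Proof.
move=> eC; apply/stableP/and3P => [H|[vv /forall_inP vB /stableP BB] x y].
  split; first by apply: H; rewrite setU11.
    by apply/forall_inP => w wB; apply: H; rewrite ?setU11 // !inE wB orbT.
  by apply/stableP => x y xB yB; apply: H; rewrite !inE ?xB ?yB orbT.
rewrite !inE => /orP[/eqP->|xB] /orP[/eqP->|yB] //; first exact: vB.
  by rewrite eC; exact: vB.
exact: BB.
Qed.

Lemma stable_prob0 (R : realType) (T : finType) (p : R) (e : rel T) :
  stable_prob p e finset.set0 = 1.
Proof.
rewrite -[RHS](subset_expectation_cst T p); apply: eq_bigr => A _.
congr (_ * _); rewrite (_ : stable _ _ = true) //.
by apply/stableP => u v; rewrite !inE.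
Qed.

Lemma stable_prob_ge0 (R : realType) (T : finType) (p : R) (e : rel T) S :
  0 < p < 1 -> 0 <= stable_prob p e S.
Proof.
move=> p01; rewrite -[leLHS](subset_expectation_cst T p).
exact: subset_expectation_le.
Qed.

(** Shrinking the vertex set only removes constraints. *)
Lemma stable_prob_sub (R : realType) (T : finType) (p : R) (e : rel T)
    (S' S : {set T}) :
  0 < p < 1 -> S' \subset S -> stable_prob p e S <= stable_prob p e S'.
Proof.
move=> p01 /fintype.subsetP sS; apply: subset_expectation_le => // A.
have [/stableP st|_] := boolP (stable e (S :&: A)); last by rewrite ler0n.
rewrite (_ : stable _ _ = true) //; apply/stableP => u v.
rewrite !inE => /andP[/sS uS uA] /andP[/sS vS vA].
by apply: st; rewrite !inE ?uS ?vS.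
Qed.

Lemma subset_expectation_notin_stable (R : realType) (T : finType) (p : R) (e : rel T)
    (S : {set T}) (u : T) :
  expectation_random_subset p (fun A => ((u \notin A) && stable e (S :&: A))%:R) =
  (1 - p) * stable_prob p e (S :\ u).
Proof.
rewrite (subset_expectation_condition _ u).
have -> : expectation_random_subset p (fun A =>
    ((u \notin u |: A) && stable e (S :&: (u |: A)))%:R) = 0 :> R.
  by apply: big1 => A _; rewrite setU11 mulr0.
rewrite mulr0 add0r; congr (_ * _); apply: eq_bigr => A _.
rewrite !inE eqxx /=; congr (_ * (stable e _)%:R).
by apply/setP => i; rewrite !inE andbCA andbA.
Qed.

(** Once [v] is in the subset, its neighbours are excluded; otherwise [v] can be
    forgotten. *)
Lemma stable_prob_condition (R : realType) (T : finType) (p : R) (e : rel T)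
    (S : {set T}) (v : T) :
  symmetric e -> v \in S ->
  stable_prob p e S =
  p * expectation_random_subset p (fun A =>
     [&& ~~ e v v, [forall w in (S :\ v) :&: A, ~~ e v w]
       & stable e ((S :\ v) :&: A)]%:R)
  + (1 - p) * stable_prob p e (S :\ v).
Proof.
move=> eC vS; rewrite /stable_prob (subset_expectation_condition _ v).
congr (_ * _ + _ * _); apply: eq_bigr => A _; last first.
  congr (_ * (stable e _)%:R).
  by apply/setP => i; rewrite !inE andbCA andbA.
rewrite -stableU1 //; congr (_ * (stable e _)%:R).
by apply/setP => i; rewrite !inE; case: eqP => // ->; rewrite vS.
Qed.

Lemma stable_prob_isolated (R : realType) (T : finType) (p : R) (e : rel T)
    (S : {set T}) (v : T) :
  symmetric e -> v \in S -> {in S, forall w, ~~ e v w} ->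
  stable_prob p e S = stable_prob p e (S :\ v).
Proof.
move=> eC vS vn; rewrite (stable_prob_condition _ eC vS) (vn v vS) /=.
rewrite (_ : expectation_random_subset _ _ = stable_prob p e (S :\ v)).
  by rewrite -mulrDl addrC subrK mul1r.
apply: eq_bigr => A _; rewrite (_ : [forall w in _, _] = true) //.
by apply/forall_inP => w; rewrite !inE => /andP[/andP[_ wS] _]; exact: vn.
Qed.

Lemma stable_prob_loop (R : realType) (T : finType) (p : R) (e : rel T)
    (S : {set T}) (v : T) :
  symmetric e -> v \in S -> e v v ->
  stable_prob p e S = (1 - p) * stable_prob p e (S :\ v).
Proof.
move=> eC vS vv; rewrite (stable_prob_condition _ eC vS) vv /=.
rewrite (_ : expectation_random_subset _ _ = 0) ?mulr0 ?add0r //.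
by apply: big1 => A _; rewrite mulr0.
Qed.

(** If [v] is taken then [u] is excluded, which costs a factor [1 - p] and
    deletes both vertices. *)
Lemma stable_prob_leaf (R : realType) (T : finType) (p : R) (e : rel T)
    (S : {set T}) (v u : T) :
  symmetric e -> v \in S -> u \in S :\ v ->
  {in S, forall w, e v w = (w == u)} ->
  stable_prob p e S =
  p * ((1 - p) * stable_prob p e (S :\ v :\ u))
  + (1 - p) * stable_prob p e (S :\ v).
Proof.
move=> eC vS uS vE; rewrite (stable_prob_condition _ eC vS).
rewrite -(subset_expectation_notin_stable p e (S :\ v) u); congr (_ * _ + _).
have /andP[uv uS'] : (u != v) && (u \in S) by rewrite !inE in uS.
apply: eq_bigr => A _; rewrite vE // eq_sym uv /=; congr (_ * (_ && _)%:R).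
apply/forall_inP/idP => [H|uA w].
  apply/negP => uA.
  by have := H u; rewrite !inE uv uS' uA vE // eqxx => /(_ isT).
rewrite !inE => /andP[/andP[_ wS] wA]; rewrite vE //.
by apply: contraNneq uA => <-.
Qed.

(** * Peeling off leaves *)

Lemma degD1 (T : finType) (e : rel T) (S : {set T}) (u v : T) :
  v \in S -> deg e S u = (e u v + deg e (S :\ v) u)%N.
Proof. exact: big_setD1. Qed.

Lemma loopsD1 (T : finType) (e : rel T) (S : {set T}) (v : T) :
  v \in S -> loops e S = (e v v + loops e (S :\ v))%N.
Proof. exact: big_setD1. Qed.

Lemma arcsD1 (T : finType) (e : rel T) (S : {set T}) (v : T) :
  symmetric e -> v \in S ->
  arcs e S = (arcs e (S :\ v) + 2 * deg e (S :\ v) v + e v v)%N.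
Proof.
move=> eC vS; rewrite /arcs (big_setD1 v) //= (degD1 _ _ vS).
under eq_bigr => u _ do rewrite (degD1 _ _ vS) eC.
rewrite big_split /= -/(deg e (S :\ v) v); lia.
Qed.

Lemma deg_eq0 (T : finType) (e : rel T) (S : {set T}) (v : T) :
  deg e S v = 0%N -> {in S, forall w, ~~ e v w}.
Proof.
move=> /eqP; rewrite sum_nat_eq0 => /forall_inP d0 w /d0.
by case: (e v w).
Qed.

Lemma deg_sub (T : finType) (e : rel T) (S : {set T}) (v : T) :
  (deg e S v <= deg e finset.setT v)%N.
Proof.
by rewrite /deg [leqRHS](big_setID S) /= finset.setTI leq_addr.
Qed.

Lemma leaf_neighbour (T : finType) (e : rel T) (S : {set T}) (v : T) :
  (deg e S v <= 1)%N ->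
  {in S, forall w, ~~ e v w} \/
  exists2 u, u \in S & {in S, forall w, e v w = (w == u)}.
Proof.
move=> dv; case: (boolP [exists u in S, e v u]) => [/exists_inP[u uS vu]|]; last first.
  by rewrite negb_exists_in => /forall_inP; left.
right; exists u => // w wS; have [->|wu] := eqVneq; first exact: vu.
apply/negbTE; apply: (@deg_eq0 _ e (S :\ u)); last by rewrite !inE wu.
by move: dv; rewrite (degD1 _ _ uS) vu; lia.
Qed.

(** Deleting [u] as well can only increase the probability, so the leaf recursion
    gives at least [(1 - p) + p (1 - p) = 1 - p ^+ 2] times the value without
    [v], while exactly two arcs are lost.  A vertex whose only neighbour is
    itself contributes [1 - p]. *)
Lemma stable_prob_lower (R : realType) (T : finType) (p nu : R) (e : rel T)
    (S : {set T}) :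
  0 < p < 1 -> 0 <= nu <= 1 -> nu ^+ 2 <= 1 - p ^+ 2 ->
  symmetric e -> peelable e ->
  (1 - p) ^+ loops e S * nu ^+ arcs e S <= stable_prob p e S.
Proof.
move=> p01 /andP[nu0 nu1] nu2 eC ePeel; have /andP[p0 p1] := p01.
have [n] := ubnP #|S|; elim: n S => // n IH S; rewrite ltnS => Sn.
have [->|/ePeel[v vS dv]] := eqVneq S finset.set0.
  by rewrite stable_prob0 /loops /arcs !big_set0 !expr0 mulr1.
have {IH} IHv : (1 - p) ^+ loops e (S :\ v) * nu ^+ arcs e (S :\ v)
    <= stable_prob p e (S :\ v).
  by apply: IH; move: Sn; rewrite (cardsD1 v) vS.
have [vn|[u uS vE]] := leaf_neighbour dv.
  rewrite (stable_prob_isolated p eC vS vn) (le_trans _ IHv) //.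
  have vn' : deg e (S :\ v) v = 0%N.
    by apply: big1 => w; rewrite !inE => /andP[_ /vn /negPf ->].
  by rewrite (loopsD1 _ vS) (arcsD1 eC vS) vn' (negPf (vn v vS)) muln0 !addn0.
have [uv|uv] := eqVneq u v.
  have vv : e v v by rewrite vE // uv.
  have vn' : deg e (S :\ v) v = 0%N.
    by apply: big1 => w; rewrite !inE => /andP[/negPf wv wS]; rewrite vE // uv wv.
  rewrite (stable_prob_loop p eC vS vv) (loopsD1 _ vS) (arcsD1 eC vS) vn' vv.
  rewrite muln0 addn0 addn1 exprS exprSr.
  have l0 : 0 <= (1 - p) ^+ loops e (S :\ v) by rewrite exprn_ge0 //; lra.
  have a0 : 0 <= nu ^+ arcs e (S :\ v) by rewrite exprn_ge0.
  apply: le_trans (ler_wpM2l _ IHv); last by lra.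
  by rewrite [_ * (1 - p)]mulrC -!mulrA !ler_wpM2l ?ler_piMl //; lra.
have uSv : u \in S :\ v by rewrite !inE uv.
have vv : e v v = false by rewrite vE // eq_sym (negPf uv).
have dv1 : deg e (S :\ v) v = 1%N.
  rewrite (degD1 _ _ uSv) vE // eqxx /deg big1 // => w.
  by rewrite !inE => /and3P[/negPf wu _ wS]; rewrite vE // wu.
rewrite (stable_prob_leaf p eC vS uSv vE) (loopsD1 _ vS) (arcsD1 eC vS) vv dv1.
rewrite addn0 add0n muln1 addnC exprD.
have le_vu : stable_prob p e (S :\ v) <= stable_prob p e (S :\ v :\ u).
  by apply: stable_prob_sub => //; apply: subD1set.
have f0 : 0 <= stable_prob p e (S :\ v) by exact: stable_prob_ge0.
apply: (@le_trans _ _ ((1 - p ^+ 2) * stable_prob p e (S :\ v))); last first.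
  move: le_vu; set x := stable_prob p e (S :\ v); set y := stable_prob p e _.
  move=> le_xy.
  rewrite [leRHS](_ : _ = (1 - p) * (p * y + x)); last by ring.
  rewrite [leLHS](_ : _ = (1 - p) * (p * x + x)); last by ring.
  by rewrite ler_wpM2l ?lerD2r ?ler_wpM2l //; lra.
rewrite mulrCA ler_pM // ?mulr_ge0 ?exprn_ge0 //; lra.
Qed.

(** The condition on [mu ^+ 4] is what the leaf recursion needs when [u] has a
    second neighbour, so that deleting [u] and [v] costs four arcs; this is the
    recursion for a long path.  If [u] loses fewer arcs the requirement is
    weaker, because [mu ^+ 2 >= 1 - p ^+ 2 >= 1 - p]. *)
Lemma stable_prob_upper (R : realType) (T : finType) (p mu : R) (e : rel T)
    (S : {set T}) :
  0 < p < 1 -> 0 <= mu <= 1 -> 1 - p ^+ 2 <= mu ^+ 2 ->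
  (1 - p) * mu ^+ 2 + p * (1 - p) <= mu ^+ 4 ->
  symmetric e -> peelable e -> (forall v, deg e finset.setT v <= 2)%N ->
  stable_prob p e S <= mu ^+ arcs e S.
Proof.
move=> p01 /andP[mu0 mu1] mu2 mu4 eC ePeel e2; have /andP[p0 p1] := p01.
have [n] := ubnP #|S|; elim: n S => // n IH S; rewrite ltnS => Sn.
have [->|/ePeel[v vS dv]] := eqVneq S finset.set0.
  by rewrite stable_prob0 /arcs big_set0 expr0.
have Svn : (#|S :\ v| < n)%N by move: Sn; rewrite (cardsD1 v) vS.
have IHv : stable_prob p e (S :\ v) <= mu ^+ arcs e (S :\ v) by exact: IH.
have [vn|[u uS vE]] := leaf_neighbour dv.
  rewrite (stable_prob_isolated p eC vS vn) (le_trans IHv) //.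
  have vn' : deg e (S :\ v) v = 0%N.
    by apply: big1 => w; rewrite !inE => /andP[_ /vn /negPf ->].
  by rewrite (arcsD1 eC vS) vn' (negPf (vn v vS)) muln0 !addn0.
have [uv|uv] := eqVneq u v.
  have vv : e v v by rewrite vE // uv.
  have vn' : deg e (S :\ v) v = 0%N.
    by apply: big1 => w; rewrite !inE => /andP[/negPf wv wS]; rewrite vE // uv wv.
  rewrite (stable_prob_loop p eC vS vv) (arcsD1 eC vS) vn' vv.
  rewrite muln0 addn0 addn1 exprS ler_pM ?stable_prob_ge0 //; first lra.
  nra.
have uSv : u \in S :\ v by rewrite !inE uv.
have vv : e v v = false by rewrite vE // eq_sym (negPf uv).
have dv1 : deg e (S :\ v) v = 1%N.
  rewrite (degD1 _ _ uSv) vE // eqxx /deg big1 // => w.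
  by rewrite !inE => /and3P[/negPf wu _ wS]; rewrite vE // wu.
have IHu : stable_prob p e (S :\ v :\ u) <= mu ^+ arcs e (S :\ v :\ u).
  by apply: IH; apply: leq_ltn_trans Svn; rewrite subset_leq_card ?subD1set.
rewrite (stable_prob_leaf p eC vS uSv vE) (arcsD1 eC vS) vv dv1 addn0 muln1.
(* k counts the arcs at u other than those to v: none, one for a loop, or two
   for a second neighbour. *)
have [k k2 arcsE] : exists2 k, (k <= 2)%N &
    arcs e (S :\ v) = (arcs e (S :\ v :\ u) + k)%N.
  exists (2 * deg e (S :\ v :\ u) u + e u u)%N; last by rewrite (arcsD1 eC uSv) addnA.
  have := leq_trans (deg_sub e S u) (e2 u).
  rewrite (degD1 _ _ vS) (degD1 _ _ uSv) eC vE // eqxx.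
  rewrite !add1n ltnS /=; clear; move: (deg _ _ _) => d.
  by case: (e u u) => /=; lia.
move: IHv; rewrite arcsE -addnA !(exprD _ (arcs _ _)) => IHv.
set a := mu ^+ arcs _ _ in IHu IHv *.
have a0 : 0 <= a by exact: exprn_ge0.
have key : p * (1 - p) + (1 - p) * mu ^+ k <= mu ^+ (k + 2).
  have mk : mu ^+ 2 <= mu ^+ k by apply: ler_wiXn2l.
  have mm : mu ^+ 4 = mu ^+ 2 * mu ^+ 2 by ring.
  rewrite exprD; move: mk mu4 mu2; rewrite mm.
  move: (mu ^+ 2) (mu ^+ k) => x y xy xx px.
  have xp : 0 <= x - (1 - p) by nra.
  have : 0 <= (y - x) * (x - (1 - p)) by rewrite mulr_ge0 // subr_ge0.
  nra.
apply: (@le_trans _ _ (a * (p * (1 - p) + (1 - p) * mu ^+ k))); last by rewrite ler_wpM2l.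
rewrite mulrDr; apply: lerD.
  by rewrite [leLHS]mulrA [leRHS]mulrC ler_wpM2l // mulr_ge0 //; lra.
by rewrite mulrCA ler_wpM2l //; lra.
Qed.

(** * The graph of pairs with a prescribed sum *)

Definition sum_rel (N m n : nat) : rel 'I_N.+1 :=
  fun i j => (i + j == m)%N || (i + j == n)%N.

Lemma mem_sumsetP (N : nat) (A : {set 'I_N.+1}) (n : nat) :
  reflect (exists2 a, a \in A & exists2 b, b \in A & n = (a + b)%N)
          (n \in sumset A).
Proof.
apply: (iffP allpairsP) => [[[a b] /= [aA bA ->]]|[a aA [b bA ->]]].
  by move: aA bA; rewrite !mem_enum => aA bA; exists a => //; exists b.
by exists (a, b); rewrite !mem_enum.
Qed.

Lemma stable_sum_rel (N : nat) (m n : 'I_N.+1) (A : {set 'I_N.+1}) :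
  stable (sum_rel m n) A = (m \in missing_sums A) && (n \in missing_sums A).
Proof.
rewrite !inE; apply/stableP/andP => [st|[/mem_sumsetP mA /mem_sumsetP nA] u v uA vA].
  split; apply/mem_sumsetP => -[a aA [b bA]] eab;
    by have := st a b aA bA; rewrite /sum_rel -eab eqxx ?orbT.
apply/orP => -[/eqP e|/eqP e]; first by apply: mA; exists u => //; exists v.
by apply: nA; exists u => //; exists v.
Qed.

Lemma sum_rel_sym (N m n : nat) : symmetric (@sum_rel N m n).
Proof. by move=> i j; rewrite /sum_rel addnC. Qed.

Lemma sum_relC (N m n : nat) : @sum_rel N m n = sum_rel n m.
Proof. by apply/funext => i; apply/funext => j; rewrite /sum_rel orbC. Qed.

Lemma sum_shift_eq (k v m : nat) :
  (\sum_(w < k) (v + w == m))%N = (v <= m < v + k)%N.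
Proof.
elim: k => [|k IH]; first by rewrite big_ord0; lia.
rewrite big_ord_recr /= {}IH; lia.
Qed.

Lemma sum_shift_eq_le1 (N : nat) (S : {set 'I_N.+1}) (v m : nat) :
  (\sum_(w in S) (v + w == m) <= 1)%N.
Proof.
apply: (@leq_trans (\sum_(w < N.+1) (v + w == m))).
  by rewrite [leqRHS](bigID (mem S)) /= leq_addr.
by rewrite sum_shift_eq leq_b1.
Qed.

Lemma deg_sum_rel (N m n : nat) (S : {set 'I_N.+1}) (v : 'I_N.+1) :
  m != n ->
  deg (sum_rel m n) S v =
  (\sum_(w in S) (v + w == m) + \sum_(w in S) (v + w == n))%N.
Proof.
move=> mn; rewrite -big_split; apply: eq_bigr => w _ /=.
by rewrite /sum_rel; case: eqP => //= ->; rewrite (negPf mn).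
Qed.

Lemma deg_sum_rel_diag (N n : nat) (S : {set 'I_N.+1}) (v : 'I_N.+1) :
  deg (sum_rel n n) S v = (\sum_(w in S) (v + w == n))%N.
Proof. by apply: eq_bigr => w _; rewrite /sum_rel orbb. Qed.

Lemma deg_sum_rel_le2 (N m n : nat) (S : {set 'I_N.+1}) (v : 'I_N.+1) :
  (deg (sum_rel m n) S v <= 2)%N.
Proof.
have [<-|mn] := eqVneq m n.
  by rewrite deg_sum_rel_diag (leq_trans (sum_shift_eq_le1 _ _ _)).
by rewrite deg_sum_rel // (leq_add (sum_shift_eq_le1 _ _ _) (sum_shift_eq_le1 _ _ _)).
Qed.

(** If the maximum [v] of [S] has two neighbours, one of them is [w = m - v].  For
    the minimum [u] and any [x] in [S], then, [u + x <= w + v = m < n], so [u]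
    has at most one neighbour. *)
Lemma peelable_sum_rel (N m n : nat) : (m <= n)%N -> peelable (@sum_rel N m n).
Proof.
move=> le_mn S /finset.set0Pn[x0 x0S].
have [eq_mn|mn] := eqVneq m n.
  by exists x0; rewrite // -eq_mn deg_sum_rel_diag sum_shift_eq_le1.
have [v vS vmax] : exists2 v, v \in S & forall x, x \in S -> (x <= v)%N.
  by case: (arg_maxnP (fun x : 'I_N.+1 => x : nat) x0S) => v; exists v.
have [u uS umin] : exists2 u, u \in S & forall x, x \in S -> (u <= x)%N.
  by case: (arg_minnP (fun x : 'I_N.+1 => x : nat) x0S) => u; exists u.
have [|dv] := leqP (deg (sum_rel m n) S v) 1; first by exists v.
have [w wS /eqP vw] : exists2 w, w \in S & (v + @nat_of_ord N.+1 w == m)%N.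
  apply/exists_inP; apply: contraLR dv.
  rewrite negb_exists_in -leqNgt => /forall_inP vm.
  rewrite deg_sum_rel // big1 ?add0n ?sum_shift_eq_le1 // => w /vm /negPf ->.
  by [].
exists u => //; rewrite deg_sum_rel // [X in (_ + X)%N]big1 ?addn0 ?sum_shift_eq_le1 //.
move=> x xS; apply/eqP; rewrite eqb0; have := vmax x xS; have := umin w wS; lia.
Qed.

Lemma sum_le_ord (k m : nat) : (m < k)%N -> (\sum_(i < k) (i <= m))%N = m.+1.
Proof.
move=> mk; suff -> : (\sum_(i < k) (i <= m))%N = minn k m.+1 by lia.
elim: k {mk} => [|k IH]; first by rewrite big_ord0; lia.
rewrite big_ord_recr /= IH; lia.
Qed.

Lemma sum_shift_eq_setT (N m : nat) (v : 'I_N.+1) : (m <= N)%N ->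
  (\sum_(w in finset.setT) (v + @nat_of_ord N.+1 w == m))%N = (v <= m)%N.
Proof.
move=> mN; under eq_bigl do rewrite inE.
by rewrite sum_shift_eq; have := ltn_ord v; lia.
Qed.

Lemma arcs_sum_rel (N m n : nat) : (m < n <= N)%N ->
  arcs (@sum_rel N m n) finset.setT = (m.+1 + n.+1)%N.
Proof.
move=> /andP[mn nN]; rewrite /arcs.
have mn' : m != n by rewrite ltn_eqF.
have mN : (m <= N)%N by apply: leq_trans nN; apply: ltnW.
under eq_bigr => v _ do rewrite (deg_sum_rel _ _ mn') !sum_shift_eq_setT //.
under eq_bigl do rewrite inE.
by rewrite big_split /= !sum_le_ord //; lia.
Qed.

Lemma arcs_sum_rel_diag (N n : nat) : (n <= N)%N ->
  arcs (@sum_rel N n n) finset.setT = n.+1.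
Proof.
move=> nN; rewrite /arcs.
under eq_bigr => v _ do rewrite deg_sum_rel_diag sum_shift_eq_setT //.
by under eq_bigl do rewrite inE; rewrite sum_le_ord.
Qed.

Lemma loops_sum_rel_diag (N n : nat) :
  (loops (@sum_rel N n n) finset.setT <= 1)%N.
Proof.
rewrite /loops; under eq_bigl do rewrite inE.
under eq_bigr do rewrite /sum_rel orbb.
suff : (\sum_(i < N.+1) (i + i == n) <= (n < N.+1 + N.+1))%N.
  by move=> /leq_trans; apply; apply: leq_b1.
elim: N.+1 => [|k IH]; first by rewrite big_ord0.
rewrite big_ord_recr /=; move: IH; move: (\sum_(i < k) _)%N => s.
by do 2 case: ltnP; case: eqP => /=; lia.
Qed.

(** * The second moment of Y *)

Lemma YE (R : realType) (N : nat) (A : {set 'I_N.+1}) :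
  Y R A = \sum_(n < N.+1) (n \in missing_sums A)%:R.
Proof.
rewrite /Y -sum1_card natr_sum big_mkcond.
by apply: eq_bigr => n _; case: ifP.
Qed.

Lemma expectation_Y (R : realType) (p : R) (N : nat) :
  expectation_random_subset p (fun A : {set 'I_N.+1} => Y R A) =
  \sum_(n < N.+1) stable_prob p (@sum_rel N n n) finset.setT.
Proof.
under [LHS]eq_bigr do rewrite YE.
rewrite -/(expectation_random_subset _ _) subset_expectation_sum.
apply: eq_bigr => n _; apply: eq_bigr => A _.
by rewrite finset.setTI stable_sum_rel andbb.
Qed.

Lemma expectation_Y2 (R : realType) (p : R) (N : nat) :
  expectation_random_subset p (fun A : {set 'I_N.+1} => Y R A ^+ 2) =
  \sum_(m < N.+1) \sum_(n < N.+1)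
    stable_prob p (@sum_rel N m n) finset.setT.
Proof.
under [LHS]eq_bigr do rewrite YE expr2 big_distrlr.
rewrite -/(expectation_random_subset _ _) subset_expectation_sum.
apply: eq_bigr => m _; rewrite subset_expectation_sum.
apply: eq_bigr => n _; apply: eq_bigr => A _.
by rewrite finset.setTI stable_sum_rel -mulnb natrM.
Qed.

(** A representation of [n <= N] as a sum only uses summands up to [N], so
    removing [N + 1] from [A] does not create a representation or destroy one. *)
Lemma missing_sums_restrict (N : nat) (A : {set 'I_N.+2}) :
  (#|missing_sums (widen_ord (leqnSn N.+1) @^-1: A)| <=
   #|missing_sums A|)%N.
Proof.
set h := widen_ord _.
have hI : injective h by move=> i j /(congr1 val) /= /val_inj.
rewrite -(card_imset _ hI) subset_leq_card //.
apply/fintype.subsetP => _ /imsetP[n + ->].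
rewrite !inE; apply: contraNN => /mem_sumsetP[a aA [b bA nab]].
have [a' aE] : exists a', a = h a'.
  have aN : (a < N.+1)%N by have := ltn_ord n; move: nab; rewrite /h /=; lia.
  by exists (Ordinal aN); apply: val_inj.
have [b' bE] : exists b', b = h b'.
  have bN : (b < N.+1)%N by have := ltn_ord n; move: nab; rewrite /h /=; lia.
  by exists (Ordinal bN); apply: val_inj.
apply/mem_sumsetP; exists a'; first by rewrite inE -aE.
by exists b'; [rewrite inE -bE | move: nab; rewrite aE bE].
Qed.

(** Both expectations are computed with one random subset of [{0, ..., N + 1}]
    and its trace on [{0, ..., N}]. *)
Lemma expectation_Y2_nondecreasing (R : realType) (p : R) : 0 < p < 1 ->
  {homo (fun N => expectation_random_subset p
    (fun A : {set 'I_N.+1} => Y R A ^+ 2)) : n m / (n <= m)%N >-> n <= m}.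
Proof.
move=> p01; apply: homo_leq => [x|y x z|N]; [exact: lexx|exact: le_trans|].
have hI : injective (widen_ord (leqnSn N.+1)).
  by move=> i j /(congr1 val) /= /val_inj.
rewrite -(subset_expectation_preimset p _ hI).
apply: subset_expectation_le => // A.
by rewrite lerXn2r ?nnegrE ?ler0n // ler_nat missing_sums_restrict.
Qed.

Lemma sum_geometric_le (R : realType) (mu : R) (k : nat) :
  0 <= mu < 1 -> \sum_(i < k) mu ^+ i <= (1 - mu)^-1.
Proof.
move=> /andP[mu0 mu1]; have d0 : 0 < 1 - mu by rewrite subr_gt0.
rewrite -[leRHS]mul1r ler_pdivlMr // mulrC.
have := subrX1 mu k; have : 0 <= mu ^+ k by exact: exprn_ge0.
by move: (\sum_(i < k) _) (mu ^+ k) => s x *; lra.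
Qed.

Lemma expectation_Y2_le (R : realType) (p : R) (N : nat) : 0 < p < 1 ->
  expectation_random_subset p (fun A : {set 'I_N.+1} => Y R A ^+ 2) <=
  (2 * (1 + p) / p ^+ 2) ^+ 2 + 2 * (1 + p) / p ^+ 2.
Proof.
move=> p01; set c := 2 * _ / _; have /andP[p0 p1] := p01.
(* With mu ^+ 2 = 1 - x, the condition on mu ^+ 4 of the upper bound reads
   x * (1 + p - x) <= p ^+ 2, which this x satisfies with x ^+ 2 to spare. *)
pose x := p ^+ 2 / (1 + p).
have xE : x * (1 + p) = p ^+ 2 by rewrite divfK //; lra.
have x0 : 0 < x by rewrite divr_gt0 ?exprn_gt0 //; lra.
have xp : x <= p ^+ 2 by nra.
have x1 : x < 1 by nra.
pose mu := Num.sqrt (1 - x).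
have mu2 : mu ^+ 2 = 1 - x by rewrite sqr_sqrtr //; lra.
have mu0 : 0 <= mu by exact: sqrtr_ge0.
have mu1 : mu < 1 by nra.
have sumle k : \sum_(i < k) mu ^+ i <= c.
  apply: le_trans (sum_geometric_le _ _) _; first by rewrite mu0.
  have -> : c = 2 / x by rewrite /c -xE -mulf_div divff ?mulr1 //; lra.
  rewrite ler_pdivlMr // mulrC ler_pdivrMr; last by lra.
  nra.
have c0 : 0 <= c by rewrite divr_ge0 ?exprn_ge0 //; lra.
(* The last term accounts for the diagonal, which has only n + 1 arcs. *)
pose F m n : R := mu ^+ m * mu ^+ n + (m == n)%:R * mu ^+ n.
have FC m n : F m n = F n m.
  by rewrite /F eq_sym [X in X + _]mulrC; case: eqP => [->|_] //; rewrite !mul0r.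
have le_F (m n : nat) : (m <= n <= N)%N ->
    stable_prob p (@sum_rel N m n) finset.setT <= F m n.
  move=> /andP[mn nN].
  apply: (@le_trans _ _ (mu ^+ arcs (@sum_rel N m n) finset.setT)).
    apply: stable_prob_upper => //; [by rewrite mu0 ltW|by rewrite mu2; lra| | | | ].
    - rewrite (exprM _ 2 2) mu2; nra.
    - exact: sum_rel_sym.
    - exact: peelable_sum_rel.
    - by move=> v; exact: deg_sum_rel_le2.
  rewrite /F; have [<-|neq] := eqVneq m n.
    rewrite arcs_sum_rel_diag ?(leq_trans mn) // mul1r.
    rewrite -[leLHS]add0r lerD ?mulr_ge0 ?exprn_ge0 //.
    by rewrite ler_wiXn2l ?(ltW mu1).
  rewrite mul0r addr0 -exprD arcs_sum_rel; last by rewrite ltn_neqAle neq mn nN.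
  by rewrite ler_wiXn2l ?(ltW mu1) //; lia.
rewrite expectation_Y2; apply: (@le_trans _ _ (\sum_(m < N.+1) \sum_(n < N.+1) F m n)).
  apply: ler_sum => m _; apply: ler_sum => n _.
  have [mn|nm] := leqP m n; first by rewrite le_F // mn -ltnS ltn_ord.
  by rewrite sum_relC FC le_F // (ltnW nm) -ltnS ltn_ord.
under eq_bigr do rewrite big_split.
rewrite big_split /= lerD //.
  have -> : \sum_(m < N.+1) \sum_(n < N.+1) mu ^+ m * mu ^+ n =
      (\sum_(m < N.+1) mu ^+ m) ^+ 2 by rewrite expr2 big_distrlr.
  by rewrite expr2 ler_pM // sumr_ge0 // => i _; rewrite exprn_ge0.
apply: le_trans (sumle N.+1); apply: ler_sum => m _.
rewrite (bigD1 m) //= eqxx mul1r big1 ?addr0 // => n nm.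
by rewrite eq_sym -(inj_eq val_inj) in nm; rewrite (negPf nm) mul0r.
Qed.

(** The factor [1 - p] pays for the loop at [n / 2] when [n] is even; the rest is
    a geometric sum, with [1 - nu] rewritten as [p ^+ 2 / (1 + nu)]. *)
Lemma expectation_Y_ge (R : realType) (p nu : R) (N : nat) :
  0 < p < 1 -> 0 <= nu < 1 -> nu ^+ 2 = 1 - p ^+ 2 ->
  (1 - p) * nu * (1 + nu) / p ^+ 2 * (1 - nu ^+ N.+1) <=
  expectation_random_subset p (fun A : {set 'I_N.+1} => Y R A).
Proof.
move=> p01 /andP[nu0 nu1] nu2; have /andP[p0 p1] := p01.
rewrite expectation_Y.
apply: (@le_trans _ _ (\sum_(n < N.+1) (1 - p) * nu ^+ n.+1)).
  under eq_bigr do rewrite exprS.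
  rewrite -!mulr_sumr.
  have -> : 1 - nu ^+ N.+1 = (1 - nu) * \sum_(i < N.+1) nu ^+ i.
    by rewrite -[LHS]opprB subrX1 -mulNr opprB.
  move: (\sum_(i < _) _) => s.
  rewrite le_eqVlt; apply/orP; left; apply/eqP.
  have pE : p ^+ 2 = (1 - nu) * (1 + nu) by rewrite -subr_sqr; lra.
  rewrite pE; field; lra.
apply: ler_sum => n _.
have nN : (n <= N)%N by rewrite -ltnS.
apply: le_trans (@stable_prob_lower _ _ p nu _ _ p01 _ _ _ _); last first.
- exact: peelable_sum_rel.
- exact: sum_rel_sym.
- by rewrite nu2.
- by rewrite nu0 ltW.
rewrite arcs_sum_rel_diag // ler_wpM2r ?exprn_ge0 //.
rewrite -[leLHS]expr1 ler_wiXn2l ?loops_sum_rel_diag //; lra.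
Qed.

(** * The limit and its expansion *)

Local Open Scope classical_set_scope.

Lemma cvg_expectation_Y2 (R : realType) (p : R) : 0 < p < 1 ->
  cvgn (fun N => expectation_random_subset p
    (fun A : {set 'I_N.+1} => Y R A ^+ 2)).
Proof.
move=> p01; apply: nondecreasing_is_cvgn.
  exact: expectation_Y2_nondecreasing.
by eexists => _ [N _ <-]; exact: expectation_Y2_le.
Qed.

Lemma limit_expectation_Y2_bounds (R : realType) (p : R) : 0 < p < 1 ->
  `| p ^+ 4 * limn (fun N => expectation_random_subset p
       (fun A : {set 'I_N.+1} => Y R A ^+ 2)) - 4 | <= 20 * p.
Proof.
move=> p01; set L := limn _; have /andP[p0 p1] := p01.
have cvgL := cvg_expectation_Y2 p01.
have p4E : p ^+ 4 = p ^+ 2 * p ^+ 2 by rewrite -exprD.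
have p2 : 0 < p ^+ 2 by rewrite exprn_gt0.
have upper : L <= (2 * (1 + p) / p ^+ 2) ^+ 2 + 2 * (1 + p) / p ^+ 2.
  by apply: limr_le => //; near=> N; exact: expectation_Y2_le.
pose nu := Num.sqrt (1 - p ^+ 2).
have nu2 : nu ^+ 2 = 1 - p ^+ 2 by rewrite sqr_sqrtr //; nra.
have nu0 : 0 <= nu by exact: sqrtr_ge0.
have nu1 : nu < 1 by nra.
have nup : 1 - p <= nu by rewrite leNgt; apply/negP => ?; nra.
pose c := (1 - p) * nu * (1 + nu) / p ^+ 2.
have c0 : 0 <= c by rewrite divr_ge0 ?mulr_ge0 //; lra.
have lower : c ^+ 2 <= L.
  have cvgc : (c * (1 - nu ^+ N.+1)) ^+ 2 @[N --> \oo] --> c ^+ 2.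
    have nuX : nu ^+ N.+1 @[N --> \oo] --> (0 : R).
      by rewrite (cvg_shiftS (fun N => nu ^+ N)); apply: cvg_expr; rewrite ger0_norm.
    rewrite -[c in X in _ --> X]mulr1 -[X in c * X]subr0 !expr2.
    have h : c * (1 - nu ^+ N.+1) @[N --> \oo] --> c * (1 - 0).
      by apply: cvgM; [exact: cvg_cst|apply: cvgB => //; exact: cvg_cst].
    exact: (cvgM h h).
  apply: (ler_cvg_to cvgc cvgL); near=> N.
  apply: le_trans (subset_expectation_sqr_ge _ p01).
  rewrite lerXn2r ?nnegrE ?expectation_Y_ge ?nu0 ?nu1 //.
    by rewrite mulr_ge0 // subr_ge0 exprn_ile1 // ltW.
  rewrite expectation_Y; apply: sumr_ge0 => n _; exact: stable_prob_ge0.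
have up : p ^+ 4 * L <= 4 * (1 + p) ^+ 2 + 2 * (1 + p) * p ^+ 2.
  apply: (@le_trans _ _ (p ^+ 4 * ((2 * (1 + p) / p ^+ 2) ^+ 2 + 2 * (1 + p) / p ^+ 2))).
    by rewrite ler_wpM2l // exprn_ge0 // ltW.
  by rewrite le_eqVlt; apply/orP; left; apply/eqP; field; lra.
have lo : ((1 - p) * nu * (1 + nu)) ^+ 2 <= p ^+ 4 * L.
  apply: (@le_trans _ _ (p ^+ 4 * c ^+ 2)); last first.
    by rewrite ler_wpM2l // exprn_ge0 // ltW.
  by rewrite /c le_eqVlt; apply/orP; left; apply/eqP; field; lra.
(* Replaces nu by its lower bound 1 - p, to leave a polynomial in p. *)
have lo' : (1 - p) ^+ 2 * (2 - p) <= (1 - p) * nu * (1 + nu).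
  rewrite expr2 -!mulrA ler_wpM2l ?ler_pM //; lra.
have lo2 : ((1 - p) ^+ 2 * (2 - p)) ^+ 2 <= p ^+ 4 * L.
  apply: le_trans lo; rewrite lerXn2r ?nnegrE //.
    by rewrite mulr_ge0 ?exprn_ge0 //; lra.
  by rewrite !mulr_ge0 //; lra.
have lo3 : 2 - 5 * p <= (1 - p) ^+ 2 * (2 - p).
  rewrite -subr_ge0 [leRHS](_ : _ = p ^+ 2 * (4 - p)); last by ring.
  by rewrite mulr_ge0 //; lra.
rewrite ler_norml; apply/andP; split; last by nra.
by move: lo2 lo3; move: (_ * (2 - p)) (_ * L) => y z; have := sqr_ge0 (y - 2); lra.
Unshelve. all: end_near. Qed.

Theorem proposition6p4 (R : realType) :
  exists delta : R -> R,
    (forall p : R, 0 < p < 1 ->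
       expectation_random_subset p (fun A : {set 'I_N.+1} => Y R A ^+ 2)
         @[N --> \oo] --> 4 / p ^+ 4 + delta p) /\
    delta p / p ^- 4 @[p --> 0^'+] --> (0 : R).
Proof.
pose L (p : R) := limn (fun N => expectation_random_subset p
    (fun A : {set 'I_N.+1} => Y R A ^+ 2)).
exists (fun p => L p - 4 / p ^+ 4); split=> [p p01|].
  by rewrite addrC subrK; exact: cvg_expectation_Y2.
apply: (@squeeze_cvgr _ _ _ R (fun p => - (20 * p)) (fun p => 20 * p)).
- near=> p.
  have p0 : 0 < p by near: p; exact: nbhs_right_gt.
  have p1 : p < 1 by near: p; exact: nbhs_right_lt.
  have -> : (L p - 4 / p ^+ 4) / p ^- 4 = p ^+ 4 * L p - 4.
    by rewrite invrK mulrBl divfK ?expf_neq0 ?gt_eqF // mulrC.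
  by rewrite -ler_norml; apply: limit_expectation_Y2_bounds; rewrite p0.
- rewrite -[X in _ --> X]oppr0; apply: cvgN.
  rewrite -[X in _ --> X](mulr0 20).
  by apply: cvgM; [exact: cvg_cst|exact: cvg_at_right_filter].
- rewrite -[X in _ --> X](mulr0 20).
  by apply: cvgM; [exact: cvg_cst|exact: cvg_at_right_filter].
Unshelve. all: end_near. Qed.
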